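(* Consider a principal-agent setting with $n$ actions. For every $\gamma\in(0,1)$ and every $\delta>0$ there is a $\delta$-IC linear contract whose expected payoff $ALG$ to the principal satisfies \[ ALG\ \ge\ (1-\gamma)\,\frac{1}{\lceil \log_{1+\delta}(1/\gamma)\rceil+1}\,\max_{i\in[n]}\{R_i-c_i\}. \]
   Context: A principal-agent setting consists of an item set $M=\{1,\dots,m\}$ with rewards $r_j\ge 0$; $n$ actions $a_1,\dots,a_n$ with costs $0=c_1\le\dots\le c_n$; and for each action $a_i$ probabilities $q_{i,1},\dots,q_{i,m}\in[0,1]$. If the agent takes $a_i$, the outcome is a random set $S\subseteq M$ containing each item $j$ independently with probability $q_{i,j}$, so $q_{i,S}=\prod_{j\in S}q_{i,j}\prod_{j\notin S}(1-q_{i,j})$. The principal's reward for $S$ is $r_S=\sum_{j\in S}r_j$, and $R_i=\sum_j q_{i,j}r_j$; it is assumed $R_i-c_i\ge0$. Standing assumptions: normalization ($R_i\le1$ for all $i$) and no dominated actions (the $R_i$ are distinct and $R_{i'}<R_i$ implies $c_{i'}<c_i$). A contract is a vector $p=(p_S)_{S\subseteq M}$ of nonnegative payments; $p_i=\sum_S q_{i,S}p_S$. Under $p$ the agent's utility from $a_i$ is $p_i-c_i$ and the principal's payoff is $R_i-p_i$. For $\delta\ge0$, $a_i$ is $\delta$-IC under $p$ if $p_i-c_i\ge p_{i'}-c_{i'}-\delta$ for all $i'\ne i$. Among the $\delta$-IC actions the agent chooses one maximizing the principal's payoff, and the contract's expected payoff is the principal's payoff from that action. A linear contract with parameter $\alpha\in[0,1]$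 pays $p_S=\alpha r_S$ for every $S\subseteq M$. *)

(* Defs.v *)
From mathcomp Require Import all_boot all_order all_algebra.
From mathcomp Require Import reals exp.

Set Implicit Arguments.
Unset Strict Implicit.
Unset Printing Implicit Defensive.

Import Order.TTheory GRing.Theory Num.Theory.

Local Open Scope ring_scope.

(* Since c_1 = 0 is required, there is at least one action: the actions are    *)
(* indexed by 'I_n.+1, ord0 standing for a_1, and the items by 'I_m.           *)
Record setting (R : realType) (m n : nat) := Setting {
  reward : 'I_m -> R;
  cost : 'I_n.+1 -> R;
  prob : 'I_n.+1 -> 'I_m -> R;
  reward_ge0 : forall j, 0 <= reward j;
  cost_first : cost ord0 = 0;
  cost_nondecreasing : forall i i' : 'I_n.+1, (i <= i')%N -> cost i <= cost i';
  prob_itv : forall i j, 0 <= prob i j <= 1;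
  welfare_ge0 : forall i, 0 <= \sum_j prob i j * reward j - cost i
}.

Definition outcome_prob (R : realType) (m n : nat) (A : setting R m n)
    (i : 'I_n.+1) (S : {set 'I_m}) : R :=
  (\prod_(j in S) prob A i j) * \prod_(j in ~: S) (1 - prob A i j).

Definition outcome_reward (R : realType) (m n : nat) (A : setting R m n)
    (S : {set 'I_m}) : R :=
  \sum_(j in S) reward A j.

Definition exp_reward (R : realType) (m n : nat) (A : setting R m n)
    (i : 'I_n.+1) : R :=
  \sum_j prob A i j * reward A j.

Definition normalized (R : realType) (m n : nat) (A : setting R m n) : Prop :=
  forall i, exp_reward A i <= 1.

Definition no_dominated_actions (R : realType) (m n : nat)
    (A : setting R m n) : Prop :=
  injective (exp_reward A) /\
  forall i i', exp_reward A i' < exp_reward A i -> cost A i' < cost A i.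

Record contract (R : realType) (m : nat) := Contract {
  payment :> {set 'I_m} -> R;
  payment_ge0 : forall S, 0 <= payment S
}.

Definition exp_payment (R : realType) (m n : nat) (A : setting R m n)
    (p : contract R m) (i : 'I_n.+1) : R :=
  \sum_(S : {set 'I_m}) outcome_prob A i S * p S.

Definition agent_utility (R : realType) (m n : nat) (A : setting R m n)
    (p : contract R m) (i : 'I_n.+1) : R :=
  exp_payment A p i - cost A i.

Definition principal_payoff (R : realType) (m n : nat) (A : setting R m n)
    (p : contract R m) (i : 'I_n.+1) : R :=
  exp_reward A i - exp_payment A p i.

Definition delta_IC (R : realType) (m n : nat) (A : setting R m n) (delta : R)
    (p : contract R m) (i : 'I_n.+1) : Prop :=
  forall i', i' != i -> agent_utility A p i >= agent_utility A p i' - delta.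

Definition agent_choice (R : realType) (m n : nat) (A : setting R m n)
    (delta : R) (p : contract R m) (i : 'I_n.+1) : Prop :=
  delta_IC A delta p i /\
  forall i', delta_IC A delta p i' ->
    principal_payoff A p i' <= principal_payoff A p i.

(* All agent choices give the principal the same payoff, so this relation      *)
(* determines v.                                                               *)
Definition is_expected_payoff (R : realType) (m n : nat) (A : setting R m n)
    (delta : R) (p : contract R m) (v : R) : Prop :=
  exists2 i, agent_choice A delta p i & v = principal_payoff A p i.

Definition is_linear_contract (R : realType) (m n : nat) (A : setting R m n)
    (p : contract R m) : Prop :=
  exists2 alpha : R, 0 <= alpha <= 1 &
    forall S, p S = alpha * outcome_reward A S.

(* max_i (R_i - c_i); the default value of the iterated maximum is itself one  *)
(* of the terms.                                                               *)
Definition max_welfare (R : realType) (m n : nat) (A : setting R m n) : R :=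
  \big[Order.max/(exp_reward A ord0 - cost A ord0)]_i
    (exp_reward A i - cost A i).

Definition log_base (R : realType) (b x : R) : R := ln x / ln b.

(* Main.v *)
Require Import Defs.
From mathcomp Require Import all_boot all_order all_algebra.
From mathcomp Require Import ring lra.
From mathcomp Require Import reals exp.

Set Implicit Arguments.
Unset Strict Implicit.
Unset Printing Implicit Defensive.

Import Order.TTheory GRing.Theory Num.Theory.

Local Open Scope ring_scope.

(** Let [f alpha] be the agent's best utility under the linear contract with
    parameter [alpha].  If [alpha <= beta <= (1 + delta) alpha], an action that
    is optimal for the agent at [beta] is [delta]-IC at [alpha], as its expected
    reward is at most 1; there it pays the principal
    [(1 - alpha) R_i >= (beta - alpha) R_i >= f beta - f alpha].  Along the
    geometric grid [gamma (1 + delta)^k], capped at 1, these increments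
    telescope to [f 1 - f gamma >= (1 - gamma) max_i (R_i - c_i)], so one of the
    [ceil (log_(1 + delta) (1 / gamma))] grid contracts gets the average. *)

Lemma cost_ge0 (R : realType) (m n : nat) (A : setting R m n) i :
  0 <= cost A i.
Proof. by rewrite -(cost_first A) cost_nondecreasing. Qed.

Lemma exp_reward_ge0 (R : realType) (m n : nat) (A : setting R m n) i :
  0 <= exp_reward A i.
Proof.
apply: sumr_ge0 => j _; have /andP[q_ge0 _] := prob_itv A i j.
by rewrite mulr_ge0 ?reward_ge0.
Qed.

Lemma outcome_prob_prodE (R : realType) (m n : nat) (A : setting R m n) i S :
  outcome_prob A i S =
    \prod_j (if j \in S then prob A i j else 1 - prob A i j).
Proof.
rewrite /outcome_prob (bigID (mem S) xpredT) /=; congr (_ * _).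
  by apply: eq_bigr => j ->.
by apply: eq_big => [j|j]; rewrite in_setC // => /negbTE ->.
Qed.

(** Distributing the product of the sums [prob A i k + G k] over [k] yields one term per set [S].
    Since [G j] is 0, the sets missing [j] drop out, while the factors with [k != j] are all 1. *)
Lemma outcome_prob_marginal (R : realType) (m n : nat) (A : setting R m n) i j :
  \sum_(S : {set 'I_m} | j \in S) outcome_prob A i S = prob A i j.
Proof.
pose G k : R := if k == j then 0 else 1 - prob A i k.
have -> : prob A i j = \prod_k (prob A i k + G k).
  rewrite (bigD1 j) //= {1}/G eqxx addr0 big1 ?mulr1 // => k /negbTE kj.
  by rewrite /G kj; ring.
rewrite bigA_distr [RHS](bigID (fun S : {set 'I_m} => j \in S)) /=.
rewrite [X in _ = _ + X]big1 ?addr0 => [|S /negbTE jS]; last first.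
  by rewrite (bigD1 j) //= jS /G eqxx mul0r.
apply: eq_bigr => S jS; rewrite outcome_prob_prodE.
apply: eq_bigr => k _; case: ifPn => // kS; rewrite /G.
by case: eqP => // kj; rewrite kj jS in kS.
Qed.

Lemma linear_exp_payment (R : realType) (m n : nat) (A : setting R m n)
    (p : contract R m) (alpha : R) i :
  (forall S, p S = alpha * outcome_reward A S) ->
  exp_payment A p i = alpha * exp_reward A i.
Proof.
move=> pE; rewrite /exp_payment.
under eq_bigr => S _ do
  rewrite pE /outcome_reward big_mkcond mulrCA mulr_sumr.
rewrite -mulr_sumr exchange_big /=; congr (_ * _); apply: eq_bigr => j _.
rewrite -(outcome_prob_marginal A i j) mulr_suml [RHS]big_mkcond.
by apply: eq_bigr => S _; case: ifP => //; rewrite mulr0.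
Qed.

Lemma linear_payment_ge0 (R : realType) (m n : nat) (A : setting R m n)
    (alpha : R) (alpha_ge0 : 0 <= alpha) (S : {set 'I_m}) :
  0 <= alpha * outcome_reward A S.
Proof. by rewrite mulr_ge0 // sumr_ge0 // => j _; apply: reward_ge0. Qed.

Definition linear_contract (R : realType) (m n : nat) (A : setting R m n)
    (alpha : R) (alpha_ge0 : 0 <= alpha) : contract R m :=
  Contract (linear_payment_ge0 A alpha_ge0).

(** Ties are broken in the principal's favour, so a lower bound on the contract's payoff only
    requires exhibiting one [delta]-IC action. [P] is the boolean form of [delta_IC] over which the
    maximum is taken. *)
Lemma agent_choice_exists (R : realType) (m n : nat) (A : setting R m n)
    (delta : R) (p : contract R m) i :
  delta_IC A delta p i ->
  exists2 k, agent_choice A delta p k &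
    principal_payoff A p i <= principal_payoff A p k.
Proof.
pose P k := [forall i', (i' != k) ==>
  (agent_utility A p i' - delta <= agent_utility A p k)].
have PP k : reflect (delta_IC A delta p k) (P k).
  by apply: (iffP forallP) => H i'; [apply/implyP: (H i')|apply/implyP/H].
move=> /PP Pi.
have [k Pk kmax] := arg_maxP (principal_payoff A p) Pi.
exists k; last exact: kmax.
by split=> [|i' /PP]; [apply/PP|apply: kmax].
Qed.

Definition best_response (R : realType) (m n : nat) (A : setting R m n)
    (alpha : R) : 'I_n.+1 :=
  [arg max_(i > ord0) (alpha * exp_reward A i - cost A i)]%O.

Definition best_utility (R : realType) (m n : nat) (A : setting R m n)
    (alpha : R) : R :=
  alpha * exp_reward A (best_response A alpha)
  - cost A (best_response A alpha).

Lemma le_best_utility (R : realType) (m n : nat) (A : setting R m n) alpha i :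
  alpha * exp_reward A i - cost A i <= best_utility A alpha.
Proof.
rewrite /best_utility /best_response.
by case: arg_maxP => // k _ /(_ i); apply.
Qed.

Lemma welfare_le_max (R : realType) (m n : nat) (A : setting R m n) i :
  exp_reward A i - cost A i <= max_welfare A.
Proof. exact: (@le_bigmax _ _ _ _ (fun i => exp_reward A i - cost A i)). Qed.

Lemma max_welfare_ge0 (R : realType) (m n : nat) (A : setting R m n) :
  0 <= max_welfare A.
Proof. exact: le_trans (welfare_ge0 A ord0) (welfare_le_max _ _). Qed.

Lemma max_welfare_le_best_utility1 (R : realType) (m n : nat)
    (A : setting R m n) :
  max_welfare A <= best_utility A 1.
Proof.
by apply/bigmax_leP; split=> [|i _];
  rewrite -[X in X - _ <= _]mul1r le_best_utility.
Qed.

(** As costs are nonnegative and [gamma <= 1], scaling the cost by [gamma] as well can only raise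
    the utility. *)
Lemma best_utility_le (R : realType) (m n : nat) (A : setting R m n) gamma :
  0 <= gamma <= 1 -> best_utility A gamma <= gamma * max_welfare A.
Proof.
move=> /andP[g0 g1]; rewrite /best_utility; set i := best_response _ _.
have /(ler_wpM2l g0) := welfare_le_max A i.
have := ler_wpM2r (cost_ge0 A i) g1.
lra.
Qed.

Lemma linear_contract_payoff (R : realType) (m n : nat) (A : setting R m n)
    (delta alpha beta : R) :
  normalized A -> 0 <= delta -> 0 <= alpha -> alpha <= beta -> beta <= 1 ->
  beta <= (1 + delta) * alpha ->
  exists (p : contract R m) (v : R),
    [/\ is_linear_contract A p, is_expected_payoff A delta p v &
        best_utility A beta - best_utility A alpha <= v].
Proof.
move=> norm d0 a0 ab b1 bda; pose p := linear_contract A a0.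
have pE k : exp_payment A p k = alpha * exp_reward A k.
  exact: linear_exp_payment.
pose i := best_response A beta.
have Ri0 := exp_reward_ge0 A i.
have Ri1 := norm i.
have iIC : delta_IC A delta p i.
  move=> k _; rewrite /agent_utility !pE.
  have := le_best_utility A beta k; rewrite /best_utility -/i.
  have := ler_wpM2r (exp_reward_ge0 A k) ab.
  (* Going from [beta] down to [alpha] costs [i] exactly this amount, while a rival [k] gains
     nothing. The bound is [beta - alpha <= delta * alpha <= delta]. *)
  have : (beta - alpha) * exp_reward A i <= delta.
    rewrite (le_trans (ler_piMr _ Ri1)) ?subr_ge0 //.
    have := ler_wpM2l d0 (le_trans ab b1).
    lra.
  lra.
have [k kch kle] := agent_choice_exists iIC.
exists p, (principal_payoff A p k); split.
- by exists alpha => //; rewrite a0 (le_trans ab).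
- by exists k.
apply: le_trans kle; rewrite /principal_payoff pE.
(* Comparing with the same action [i] at [alpha] makes its cost cancel from the difference of best
   utilities. *)
have := le_best_utility A alpha i; rewrite {2}/best_utility -/i.
have := ler_wpM2r Ri0 b1.
lra.
Qed.

Lemma exists_large_increment (R : realType) (u : nat -> R) (t : R) (N : nat) :
  (0 < N)%N -> N%:R * t <= u N - u 0%N ->
  exists2 k, (k < N)%N & t <= u k.+1 - u k.
Proof.
elim: N => // -[|N] IH _; first by rewrite mul1r; exists 0%N.
have [tle _|tlt] := leP t (u N.+2 - u N.+1); first by exists N.+1.
rewrite -natr1 mulrDl mul1r => le_u.
have [|k kN kt] := IH isT; first by lra.
by exists k => //; apply: ltnW.
Qed.

(** Taking logarithms reduces this to a number being at most its ceiling; a negative ceiling is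
    harmless, being below its absolute value. *)
Lemma ler_expr_ceil_log (R : realType) (b x : R) :
  1 < b -> 0 < x -> x <= b ^+ `|Num.ceil (log_base b x)|%N.
Proof.
move=> b1 x0; have b0 : 0 < b by apply: lt_trans b1.
rewrite -ler_ln ?posrE ?exprn_gt0 // lnXn // -mulr_natl.
rewrite -ler_pdivrMr ?ln_gt0 // -/(log_base b x).
by rewrite (le_trans (ceil_ge _)) // natr_absz ler_int ler_norm.
Qed.

Theorem mainTheorem5 (R : realType) (m n : nat) (A : setting R m n)
    (A_normalized : normalized A) (A_undominated : no_dominated_actions A)
    (gamma : R) (gamma_itv : 0 < gamma < 1)
    (delta : R) (delta_gt0 : 0 < delta) :
  exists (p : contract R m) (ALG : R),
    [/\ is_linear_contract A p,
        is_expected_payoff A delta p ALG &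
        ALG >= (1 - gamma)
               * (1 / ((Num.ceil (log_base (1 + delta) (1 / gamma)))%:~R + 1))
               * max_welfare A].
Proof.
have /andP[g0 g1] := gamma_itv; have d1 : 1 < 1 + delta by rewrite ltrDl.
have d_gt0 : 0 < 1 + delta := lt_trans ltr01 d1.
have ig1 : 1 < 1 / gamma by rewrite ltr_pdivlMr // mul1r.
set c := Num.ceil _; pose N := `|c|%N.
have c_gt0 : 0 < c by rewrite ceil_gt0 divr_gt0 ?ln_gt0.
have -> : c%:~R = N%:R :> R by rewrite natr_absz gtr0_norm.
have N_gt0 : (0 < N)%N by rewrite absz_gt0 gt_eqF.
have gN : 1 <= gamma * (1 + delta) ^+ N.
  rewrite -ler_pdivrMl // mulrC.
  exact/ler_expr_ceil_log/(lt_trans ltr01 ig1).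
clearbody N; clear c c_gt0.
(* The cap keeps every parameter at most 1, and by [gN] the grid ends exactly at 1. *)
pose alpha k := Num.min 1 (gamma * (1 + delta) ^+ k).
have alphaN : alpha N = 1 by apply/min_idPl.
have alpha0 : alpha 0%N = gamma by rewrite /alpha expr0 mulr1; apply/min_idPr/ltW.
have [|k _ uk] := @exists_large_increment R (fun k => best_utility A (alpha k))
    ((1 - gamma) * (1 / (N%:R + 1)) * max_welfare A) N N_gt0.
  rewrite alphaN alpha0.
  apply: (@le_trans _ _ ((1 - gamma) * max_welfare A)); last first.
    rewrite mulrBl mul1r lerB ?max_welfare_le_best_utility1 //.
    by rewrite best_utility_le // !ltW.
  rewrite mul1r mulrAC mulrCA ler_piMr //.
    by rewrite mulr_ge0 ?max_welfare_ge0 ?subr_ge0 ?ltW.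
  by rewrite ler_pdivrMr ?mul1r ?lerDl // ltr_wpDl.
have [||||p [v [p_lin p_v le_v]]] :=
    @linear_contract_payoff R m n A delta (alpha k) (alpha k.+1) A_normalized
      (ltW delta_gt0).
- by rewrite /alpha le_min ler01 mulr_ge0 ?exprn_ge0 ?ltW.
- rewrite /alpha le_min ge_min lexx /= ge_min; apply/orP; right.
  by rewrite exprS ler_pM2l // ler_peMl ?exprn_ge0 ?ltW.
- by rewrite /alpha ge_min lexx.
(* The cap preserves the ratio bound: multiplying the minimum by [1 + delta] turns its first entry
   into [1 + delta >= 1] and its second into the next grid point. *)
- rewrite /alpha minr_pMr ?(ltW d_gt0) // mulr1 exprS mulrCA.
  by rewrite le_min !ge_min lexx orbT (ltW d1).
by exists p, v; split=> //; apply: le_trans uk le_v.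
Qed.
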